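(* Let $N\ge 1$ be an integer, let $Q_N$ be the $(N+1)\times(N+1)$ position matrix with eigenvalues $\lambda_0,\dots,\lambda_N$, and for $l\in\{0,\dots,N\}$ let $\overline{u}_l=(\overline{u}_{l,0},\dots,\overline{u}_{l,N})^T$ be an eigenvector of $Q_N$ for the eigenvalue $\lambda_l$, scaled so that $\overline{u}_{l,0}=1$. Then $$\overline{u}_{l,k}=\frac{H_k(\lambda_l)}{\sqrt{2^k\, k!}}\qquad\text{for all } k=0,1,\dots,N \text{ and all } l=0,1,\dots,N,$$ where $H_k$ denotes the $k$-th Hermite polynomial.
   Context: Rows and columns are indexed by $0,1,\dots,N$. The position matrix $Q_N$ is the real symmetric tridiagonal $(N+1)\times(N+1)$ matrix with entries $(Q_N)_{k,k+1}=(Q_N)_{k+1,k}=\sqrt{k+1}/\sqrt{2}$ for $k=0,\dots,N-1$ and all other entries $0$. The Hermite polynomials are the classical ones, given by $H_0(\lambda)=1$, $H_1(\lambda)=2\lambda$ and $H_{k+1}(\lambda)=2\lambda H_k(\lambda)-2kH_{k-1}(\lambda)$ for $k\ge 1$. *)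

(* Defs.v *)
From HB Require Import structures.
From mathcomp Require Import all_boot all_order all_algebra.

Set Implicit Arguments.
Unset Strict Implicit.
Unset Printing Implicit Defensive.

Import Order.TTheory GRing.Theory Num.Theory.
Local Open Scope ring_scope.

(* Physicists' convention: the leading coefficient of [hermite R k] is 2 ^ k. *)
Fixpoint hermite (R : comNzRingType) (n : nat) : {poly R} :=
  match n with
  | 0 => 1
  | k.+1 =>
    match k with
    | 0 => 2 *: 'X
    | j.+1 => 2 *: 'X * hermite R k - (2 * k)%:R *: hermite R j
    end
  end.

Definition position_mx (R : rcfType) (N : nat) : 'M[R]_N.+1 :=
  \matrix_(i < N.+1, j < N.+1)
    if j == i.+1 :> nat then Num.sqrt i.+1%:R / Num.sqrt 2
    else if i == j.+1 :> nat then Num.sqrt j.+1%:R / Num.sqrt 2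
    else 0.

(* The library's [eigenspace] consists of row vectors, acted on from the right;
   eigenvectors here are column vectors. *)
Definition eigenvector (R : fieldType) (n : nat) (A : 'M[R]_n) (a : R)
    (v : 'cV[R]_n) : Prop :=
  v != 0 /\ A *m v = a *: v.

(* [lambda] lists the eigenvalues of [A], with algebraic multiplicity. *)
Definition eigenvalues_of (R : fieldType) (n : nat) (A : 'M[R]_n)
    (lambda : 'I_n -> R) : Prop :=
  char_poly A = \prod_(l < n) ('X - (lambda l)%:P).

(* Main.v *)
Require Import Defs.
From HB Require Import structures.
From mathcomp Require Import all_boot all_order all_algebra.
From mathcomp Require Import ring.

Set Implicit Arguments.
Unset Strict Implicit.
Unset Printing Implicit Defensive.

Import Order.TTheory GRing.Theory Num.Theory.
Local Open Scope ring_scope.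

(** Rows [0, ..., N-1] of [Q_N u = lambda u] form a three-term recurrence which
    determines [u] from [u_0 = 1] and [lambda], and the normalized Hermite values
    [H_k(lambda) / sqrt (2^k k!)] satisfy the same recurrence. *)

(* For [k = 0] the truncated [k.-1] is harmless, as its coefficient vanishes. *)
Lemma hermiteS (R : comNzRingType) (k : nat) :
  hermite R k.+1 = 2 *: 'X * hermite R k - (2 * k)%:R *: hermite R k.-1.
Proof. by case: k => [|k] //; rewrite /= muln0 scale0r subr0 mulr1. Qed.

Definition normalized_hermite (R : rcfType) (x : R) (k : nat) : R :=
  (hermite R k).[x] / Num.sqrt (2 ^+ k * (k`!)%:R).

Lemma sqrt_expM_fact_gt0 (R : rcfType) (k : nat) :
  0 < Num.sqrt (2 ^+ k * (k`!)%:R : R).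
Proof. by rewrite sqrtr_gt0 mulr_gt0 ?exprn_gt0 ?ltr0n ?fact_gt0. Qed.

Lemma sqrt_expM_factS (R : rcfType) (k : nat) :
  Num.sqrt (2 ^+ k.+1 * ((k.+1)`!)%:R : R)
    = Num.sqrt 2 * Num.sqrt k.+1%:R * Num.sqrt (2 ^+ k * (k`!)%:R).
Proof.
by rewrite -!sqrtrM ?mulr_ge0 ?ler0n // exprS factS natrM; congr Num.sqrt; ring.
Qed.

(** This is [hermiteS] evaluated at [x] and divided by the normalizing root at [k]. At [k = 0] the
    factor [Num.sqrt 0] kills the term in [k.-1]. *)
Lemma normalized_hermiteS (R : rcfType) (x : R) (k : nat) :
  Num.sqrt k.+1%:R / Num.sqrt 2 * normalized_hermite x k.+1
    = x * normalized_hermite x k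
      - Num.sqrt k%:R / Num.sqrt 2 * normalized_hermite x k.-1.
Proof.
have sqrt_neq0 n : Num.sqrt n.+1%:R != 0 :> R by rewrite gt_eqF ?sqrtr_gt0 ?ltr0n.
have sqrtK n : n%:R = Num.sqrt n%:R * Num.sqrt n%:R :> R.
  by rewrite -expr2 sqr_sqrtr ?ler0n.
rewrite /normalized_hermite hermiteS hornerD hornerN !hornerM !hornerZ hornerX.
rewrite sqrt_expM_factS natrM.
(* Writing [2] and [k] as squares of their roots makes both sides rational in the square roots, so
   that [field] applies. *)
rewrite [X in X * x](sqrtK 2%N) [X in X * k%:R * _](sqrtK 2%N)
  [X in _ - _ * X * _](sqrtK k).
case: k => [|k].
  have := lt0r_neq0 (sqrt_expM_fact_gt0 R 0).
  rewrite sqrtr0 !(mulr0, mul0r) !subr0; move: (sqrt_neq0 0) (sqrt_neq0 1).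
  move: (Num.sqrt 1%:R) (Num.sqrt 2) (Num.sqrt (_ * _)) => a t s a0 t0 s0.
  by field; rewrite s0 a0 t0.
(* All normalizing roots are now expressed through the one at [k], the smallest index that
   occurs. *)
have := lt0r_neq0 (sqrt_expM_fact_gt0 R k); rewrite sqrt_expM_factS -[k.+1.-1]/k.
move: (sqrt_neq0 k) (sqrt_neq0 k.+1) (sqrt_neq0 1).
move: (Num.sqrt k.+1%:R) (Num.sqrt k.+2%:R) (Num.sqrt 2) (Num.sqrt (_ * _)).
move=> b a t s b0 a0 t0 s0.
by field; rewrite s0 t0 a0 b0.
Qed.

(** The two tests exclude each other, so the nested conditional is a sum. Both coefficients now
    depend on the row [i] only, so they are constant when a row is summed over [j]. *)
Lemma position_mxE (R : rcfType) (N : nat) (i j : 'I_N.+1) :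
  position_mx R N i j
    = (if j == i.+1 :> nat then Num.sqrt i.+1%:R / Num.sqrt 2 else 0)
      + (if i == j.+1 :> nat then Num.sqrt i%:R / Num.sqrt 2 else 0).
Proof.
rewrite mxE; case: eqP => [->|_].
  by rewrite -[i.+2]addn2 -[X in X == _]addn0 eqn_add2l addr0.
by case: eqP => [->|_]; rewrite add0r.
Qed.

(** The bound [k < N] makes [inord k.+1] a genuine index instead of the default [ord0]. In row [0]
    the coefficient of the truncated [k.-1] vanishes. *)
Lemma position_mx_mulE (R : rcfType) (N : nat) (v : 'cV[R]_N.+1) (k : nat) :
  (k < N)%N ->
  (position_mx R N *m v) (inord k) ord0
    = Num.sqrt k.+1%:R / Num.sqrt 2 * v (inord k.+1) ord0
      + Num.sqrt k%:R / Num.sqrt 2 * v (inord k.-1) ord0.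
Proof.
move=> ltkN.
have pick m c : (m < N.+1)%N ->
    \sum_(j < N.+1) (if j == m :> nat then c else 0) * v j ord0
      = c * v (inord m) ord0.
  move=> ltmN; rewrite (bigD1 (inord m)) //= inordK // eqxx big1 ?addr0 // => j.
  by rewrite -(inj_eq val_inj) /= inordK // => /negPf->; rewrite mul0r.
rewrite mxE; under eq_bigr do rewrite position_mxE inordK 1?ltnW // mulrDl.
rewrite big_split /= pick //; congr (_ + _).
case: k ltkN => [|k] ltkN.
  by rewrite big1 ?sqrtr0 ?mul0r // => j _; rewrite mul0r.
rewrite -pick 1?ltnW 1?ltnW //.
by apply: eq_bigr => j _; rewrite eqSS eq_sym.
Qed.

Lemma position_mx_eigenvectorE (R : rcfType) (N : nat) (x : R)
    (v : 'cV[R]_N.+1) (k : nat) :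
  position_mx R N *m v = x *: v -> v ord0 ord0 = 1 -> (k <= N)%N ->
  v (inord k) ord0 = normalized_hermite x k.
Proof.
(* The induction is strong because the recurrence reaches back two indices. *)
move=> Qv v0; elim/ltn_ind: k => -[|k] IH lekN.
  rewrite /normalized_hermite expr0 mul1r sqrtr1 divr1 hornerC -v0.
  by congr (v _ _); apply: val_inj; rewrite /= inordK.
(* The superdiagonal entry of row [k] is nonzero, so that row determines entry [k.+1] of [v]. *)
have c_neq0 : Num.sqrt k.+1%:R / Num.sqrt 2 != 0 :> R.
  by rewrite mulf_neq0 ?invr_eq0 // gt_eqF ?sqrtr_gt0 ?ltr0n.
apply: (mulfI c_neq0); rewrite normalized_hermiteS.
have le_pred : (k.-1 <= k)%N by exact: leq_pred.
rewrite -!IH ?(leq_trans le_pred) // 1?ltnW //.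
have := position_mx_mulE v lekN; rewrite Qv mxE => ->.
by rewrite addrK.
Qed.

Theorem mainTheorem2 (R : rcfType) (N : nat) (hN : (1 <= N)%N)
    (lambda : 'I_N.+1 -> R) (hlambda : eigenvalues_of (position_mx R N) lambda)
    (u : 'I_N.+1 -> 'cV[R]_N.+1)
    (hu : forall l : 'I_N.+1, eigenvector (position_mx R N) (lambda l) (u l))
    (hu0 : forall l : 'I_N.+1, u l ord0 ord0 = 1) :
  forall k l : 'I_N.+1,
    u l k ord0 = (hermite R k).[lambda l] / Num.sqrt (2 ^+ k * (k`!)%:R).
Proof.
move=> k l; have [_ Qu] := hu l.
by rewrite -[k in LHS]inord_val (position_mx_eigenvectorE Qu) // -ltnS.
Qed.
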